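(* Let $X$ be a $T_3$ topological space with $|X|\geq\operatorname{cf}(\mathfrak{c})$. Then: \begin{itemize} \item[(i)] if $X$ is Lindelöf and $\chi(X)\leq\mathfrak{c}$, then $X$ is not a $Q$-space; \item[(ii)] if $X$ is Lindelöf and locally compact, then $X$ is not a $Q$-space; \item[(iii)] if $X$ is compact, then $X$ is not a $Q$-space; \item[(iv)] if $X$ is countably compact, then $X$ is not a $Q$-space. \end{itemize}
   Context: A topological space $X$ is a $Q$-space if $X$ is not $\sigma$-discrete (i.e. $X$ is not a countable union of discrete subspaces) and every subset of $X$ is a $G_\delta$-set in $X$. $T_3$ means regular and $T_1$. $\chi(X)$ denotes the character of $X$ (the supremum over points $x\in X$ of the minimum cardinality of a local base at $x$), $\mathfrak{c}=2^{\omega}$ is the cardinality of the continuum, and $\operatorname{cf}(\mathfrak{c})$ is its cofinality. A space is countably compact if every countable open cover has a finite subcover. *)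

(* Defs.v *)
From mathcomp Require Import all_boot.
From mathcomp Require Import wochoice boolp classical_sets functions cardinality.
From mathcomp Require Import topology borel_hierarchy.

Set Implicit Arguments.
Unset Strict Implicit.
Unset Printing Implicit Defensive.

Local Open Scope classical_set_scope.
Local Open Scope card_scope.

(* Cardinal-valued functions are encoded by sets realizing their value: *)
(* a member of P of least cardinality.                                  *)
Definition has_min_card {T : Type} (P : set (set T)) (A : set T) : Prop :=
  P A /\ forall B, P B -> A #<= B.

(* The order type of R is the initial ordinal of cardinality |T|. *)
Definition initial_well_order {T : Type} (R : rel T) : Prop :=
  well_order R /\ forall x, [set y | R y x /\ y <> x] #!= [set: T].

Definition cofinal {T : Type} (R : rel T) (C : set T) : Prop :=
  forall x, exists2 y, C y & R x y.

(* |C| = cf(|T|) *)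
Definition is_cofinality {T : Type} (C : set T) : Prop :=
  exists2 R : rel T, initial_well_order R & has_min_card (cofinal R) C.

Definition continuum : Type := nat -> bool.

Section Spaces.
Variable X : topologicalType.

Definition T3_space : Prop := @regular_space X /\ @accessible_space X.

Definition discrete_subspace (D : set X) : Prop := D `<=` isolated D.

Definition sigma_discrete : Prop :=
  exists2 D : nat -> set X,
    (forall n, discrete_subspace (D n)) & \bigcup_n D n = [set: X].

Definition Q_space : Prop :=
  ~ sigma_discrete /\ forall A : set X, Gdelta A.

Definition open_cover (U : set (set X)) : Prop :=
  U `<=` open /\ \bigcup_(A in U) A = [set: X].

Definition lindelof : Prop :=
  forall U, open_cover U -> exists V : set (set X),
    [/\ V `<=` U, countable V & \bigcup_(A in V) A = [set: X]].

Definition countably_compact : Prop :=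
  forall U, countable U -> open_cover U -> exists V : set (set X),
    [/\ V `<=` U, finite_set V & \bigcup_(A in V) A = [set: X]].

Definition local_base (x : X) (B : set (set X)) : Prop :=
  B `<=` open_nbhs x /\ forall V, nbhs x V -> exists2 U, B U & U `<=` V.

(* chi(X) <= |T|; chi(X) being a supremum over points, this is *)
(* chi(x, X) <= |T| for every x.                               *)
Definition character_le (T : Type) : Prop :=
  forall x, exists2 B, has_min_card (local_base x) B & B #<= [set: T].

End Spaces.

(* Main.v *)
Require Import Defs.
From mathcomp Require Import all_boot.
From mathcomp Require Import wochoice boolp classical_sets functions cardinality.
From mathcomp Require Import topology borel_hierarchy.

Local Open Scope classical_set_scope.
Local Open Scope card_scope.

(** Suppose that every subset of [X] is a G_delta, hence also an F_sigma, and let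
    [Y] be a subset of [X] of cardinality cf(c).  All four parts are the same
    counting argument: the subsets of [Y] can be named by elements of the
    continuum, so 2^cf(c) <= c, whereas Konig's theorem gives c^cf(c) > c and
    c^cf(c) = 2^(omega * cf(c)) = 2^cf(c).  The set-theoretic contradiction is
    [continuum_not_onto_powerset_cofinality]; [cofinality_continuum_no_code]
    transports it to [X].  What remains is to name the subsets of [Y].

    Lindelof case ([lindelof_not_all_Gdelta]).  Since every subset is an
    F_sigma, [X] is hereditarily Lindelof.  Choose at each point of [Y] a local base of at
    most c sets; altogether they form a family of at most c open sets.  If
    [A `<=` Y] is the intersection of the open sets [O n], then [A] is covered
    by countably many members of the family lying inside [O n], and these
    countably many countable subfamilies determine [A].  A locally compact
    regular space whose points are G_delta is first countable
    ([countable_local_base]), so the locally compact case reduces to this one.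

    Countably compact case ([nested_compact_not_all_Gdelta]), which contains the
    compact one.  A closed discrete set is finite, and a discrete set is an
    F_sigma, so every discrete subspace is countable.  Moreover [X] is
    scattered: a nonempty crowded set would contain, by first countability, a
    countable crowded set [Q]; but [Q] is a G_delta, and a Baire category
    argument along a countable G_delta crowded set is contradictory
    ([countable_not_crowded]).  In a scattered space the isolated points of [A]
    are dense in [A], and they form a countable set because they are discrete.
    So every closed set is the closure of a countable subset, and an F_sigma
    subset of [Y] is determined by countably many sequences in [Y]. *)

(** * Konig's theorem at the cofinality of the continuum *)

Section WellOrder.
Variables (T : Type) (R : rel T).
Hypothesis wo : well_order R.

Let lt x y := R x y /\ x <> y.

Lemma wo_min (A : set T) : A !=set0 -> exists2 z, A z & forall x, A x -> R z x.
Proof.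
move=> [a Aa].
have [|z [[Az zA] _]] := wo (fun x => `[< A x >]).
  by exists a; apply/asboolP.
by exists z; [exact/asboolP | move=> x Ax; apply: zA; apply/asboolP].
Qed.

Lemma wo_total x y : R x y \/ R y x.
Proof.
have [|z [-> /(_ y)|-> /(_ x)]] := wo_min [set x; y].
- by exists x; left.
- by move=> H; left; apply: H; right.
- by move=> H; right; apply: H; left.
Qed.

Lemma wo_refl x : R x x.
Proof. by case: (wo_total x x). Qed.

Lemma wo_anti x y : R x y -> R y x -> x = y.
Proof.
move=> xy yx; have [|z [_ zU]] := wo (fun t => `[< t = x \/ t = y >]).
  by exists x; apply/asboolP; left.
transitivity z; [apply/esym|]; apply: zU; split.
- by apply/asboolP; left.
- by move=> t /asboolP[]->; rewrite ?wo_refl.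
- by apply/asboolP; right.
- by move=> t /asboolP[]->; rewrite ?wo_refl.
Qed.

Lemma wo_trans x y z : R x y -> R y z -> R x z.
Proof.
move=> xy yz; have [|t] := wo_min [set t | [\/ t = x, t = y | t = z]].
  by exists x; apply: Or31.
case=> -> m.
- by apply: m; apply: Or33.
- suff -> : x = y by [].
  by apply: wo_anti => //; apply: m; apply: Or31.
- suff <- : y = z by [].
  by apply: wo_anti => //; apply: m; apply: Or32.
Qed.

Lemma wo_nlt x y : ~ lt y x -> R x y.
Proof.
move=> nyx; have [//|yx] := wo_total x y.
by have [->|yNx] := pselect (y = x); [exact: wo_refl|case: nyx].
Qed.

Section Successor.
Variable C : set T.
Hypothesis Cnomax : forall y, C y -> exists2 z, C z & lt y z.

Lemma successor_in : exists s : T -> T, forall y, C y ->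
  [/\ C (s y), lt y (s y) & forall z, C z -> lt y z -> R (s y) z].
Proof.
suff /choice[s sP] : forall y, exists z, C y ->
    [/\ C z, lt y z & forall z', C z' -> lt y z' -> R z z'].
  by exists s.
move=> y; have [Cy|nCy] := pselect (C y); last by exists y.
have [|z [Cz yz] zmin] := wo_min (C `&` lt y).
  by have [z Cz yz] := Cnomax _ Cy; exists z.
by exists z => _; split=> // z' Cz' yz'; apply: zmin.
Qed.

(** This is the identity [kappa * omega = kappa] in disguise.  Every [y] in [C]
    is reached from a non-successor element [l y] by finitely many, say [k y],
    steps of the successor function [s] of [C]; coding [(k y, n)] by a single
    number leaves infinitely many disjoint places inside the block of [l y]. *)
Lemma no_max_setX_nat_inj : exists p : T -> nat -> T,
  (forall x n, C x -> C (p x n)) /\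
  forall x n x' n', C x -> C x' -> p x n = p x' n' -> x = x' /\ n = n'.
Proof.
have [s sP] := successor_in.
have Cs n y : C y -> C (iter n s y).
  by move=> Cy; elim: n => //= n /sP[].
have s_inj y y' : C y -> C y' -> s y = s y' -> y = y'.
  move=> Cy Cy' ss; have [_ [ys yNs] ysm] := sP _ Cy.
  have [_ [ys' yNs'] ysm'] := sP _ Cy'; apply: contrapT => ne.
  have [yy'|y'y] := wo_total y y'.
    by apply: yNs'; apply: wo_anti => //; rewrite -ss; exact: ysm.
  apply: yNs; apply: wo_anti => //; rewrite ss.
  by apply: ysm' => //; split=> // e; apply: ne.
have iter_inj n y y' : C y -> C y' -> iter n s y = iter n s y' -> y = y'.
  move=> Cy Cy'; elim: n => //= n ih /s_inj e; apply: ih; apply: e; exact: Cs.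
have iter_ge n y : C y -> R y (iter n s y).
  move=> Cy; elim: n => [|n ih] /=; first exact: wo_refl.
  by have [_ [+ _] _] := sP _ (Cs n _ Cy); exact: wo_trans.
have iter_fix n y : C y -> iter n s y = y -> n = 0.
  case: n => // n Cy; rewrite iterSr => e.
  have [Csy [ys yNs] _] := sP _ Cy; case: yNs; apply: wo_anti => //.
  by have := iter_ge n _ Csy; rewrite e.
have /choice[lk lkP] : forall y, exists lk : T * nat, C y ->
    [/\ C lk.1, iter lk.2 s lk.1 = y &
        forall z n, C z -> iter n s z = y -> R lk.1 z].
  move=> y; have [Cy|nCy] := pselect (C y); last by exists (y, 0).
  have [|l [Cl [k lky]] lmin] :=
      wo_min [set z | C z /\ exists n, iter n s z = y].
    by exists y; split=> //; exists 0.
  exists (l, k) => _; split=> // z n Cz zy.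
  by apply: lmin; split=> //; exists n.
pose p y (n : nat) := iter (pickle ((lk y).2, n)) s (lk y).1.
(* Blocks that meet have the same origin, by minimality of [(lk y).1]; the
   number of steps is then the same because [s] has no cycle. *)
have key a b y y' : C y -> C y' -> a <= b ->
    iter a s (lk y).1 = iter b s (lk y').1 -> (lk y).1 = (lk y').1 /\ a = b.
  move=> Cy Cy' ab; have [Cl ly lmin] := lkP _ Cy.
  have [Cl' ly' _] := lkP _ Cy'.
  rewrite -{1}(subnKC ab) iterD => /iter_inj e.
  have {}e : (lk y).1 = iter (b - a) s (lk y').1 by apply: e => //; exact: Cs.
  have ll' : (lk y).1 = (lk y').1.
    apply: wo_anti; last by rewrite e; exact: iter_ge.
    by apply: (lmin _ ((lk y).2 + (b - a))) => //; rewrite iterD -e.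
  split=> //; move: e; rewrite -ll' => /esym/iter_fix => /(_ Cl) /eqP.
  by rewrite subn_eq0 => ba; apply/eqP; rewrite eqn_leq ab.
exists p; split=> [x n Cx|x n x' n' Cx Cx' pp].
  by have [? _ _] := lkP _ Cx; exact: Cs.
have [ll' /(pcan_inj pickleK)[kk' nn']] :
    (lk x).1 = (lk x').1 /\ pickle ((lk x).2, n) = pickle ((lk x').2, n').
  have [ab|/ltnW ba] := leqP (pickle ((lk x).2, n)) (pickle ((lk x').2, n')).
    exact: key.
  by have [] := key _ _ _ _ Cx' Cx ba (esym pp).
have [_ <- _] := lkP _ Cx; have [_ <- _] := lkP _ Cx'.
by rewrite ll' kk'.
Qed.

End Successor.
End WellOrder.

(** An initial ordinal of infinite cardinality has no last element: below a last
    element [y] there would be all of [continuum] except [y], which still has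
    cardinality c. *)
Lemma cofinal_no_max (R : rel continuum) (C : set continuum) :
  initial_well_order R -> cofinal R C ->
  forall y, exists2 z, C z & R y z /\ y <> z.
Proof.
move=> [wo Rinit] cofC y.
have [t [yt yNt]] : exists t, R y t /\ y <> t.
  apply: contrapT => nt; apply/negP: (Rinit y); rewrite negbK.
  rewrite card_eq_le card_leT /=.
  (* Prefixing a digit that differs from the first digit of [y] injects the
     continuum into the complement of [y]. *)
  pose j (t : continuum) : continuum :=
    fun k => if k is k'.+1 then t k' else ~~ y 0.
  have j_inj : injective j.
    by move=> t t' tt'; apply/funext => k; have := congr1 (@^~ k.+1) tt'.
  apply: (@card_le_trans _ _ _ (j @` [set: continuum])).
    have : j @` setT #= [set: continuum].
      by apply: inj_card_eq => ? ? _ _ /j_inj.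
    by rewrite card_eq_le => /andP[].
  apply: subset_card_le => _ [t _ <-] /=.
  have jN : j t <> y.
    by move=> /(congr1 (@^~ 0)) /=; case: (y 0).
  split=> //; apply: (wo_nlt _ _ wo) => -[yj yNj].
  by apply: nt; exists (j t).
have [z Cz tz] := cofC t; exists z => //; split; first exact: wo_trans tz.
by move=> yz; apply: yNt; apply: (wo_anti _ _ wo) => //; rewrite yz.
Qed.

(** Konig's diagonal argument.  With [C * nat] embedded in [C], a subset of [C]
    carries a whole element of the continuum at each [y] in [C].  Fewer than c
    indices lie strictly below [y], so the subsets enumerated at those indices
    leave some value [D y] free at [y].  The subset with the values [D] differs
    from the one of index [s] at any [y] of [C] strictly above [s]. *)
Lemma continuum_not_onto_powerset_cofinality (C : set continuum) :
  is_cofinality C ->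
  ~ exists g : continuum -> set continuum,
      forall B, exists s, forall y, C y -> (g s y <-> B y).
Proof.
move=> [R Rinit [cofC _]] [g gP]; have [wo Rcard] := Rinit.
have nomax := cofinal_no_max _ _ Rinit cofC.
have [p [Cp p_inj]] := no_max_setX_nat_inj _ _ wo C (fun y _ => nomax y).
pose h (s y : continuum) : continuum := fun n => `[< g s (p y n) >].
have /choice[D DP] : forall y, exists d, forall x, R x y /\ x <> y -> h x y <> d.
  move=> y; apply: contrapT => nd; apply/negP: (Rcard y); rewrite negbK.
  rewrite card_eq_le card_leT /=; apply/pcard_surjP.
  exists (h^~ y) => d _ /=; apply: contrapT => nx; apply: nd; exists d => x xy xd.
  by apply: nx; exists x.
have [s sP] := gP [set z | exists y n, [/\ C y, z = p y n & D y n]].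
have [y Cy sy] := nomax s; apply: (DP _ _ sy).
apply/funext => n; rewrite /h.
apply/asboolP/idP => [/(sP _ (Cp _ _ Cy))|Dyn].
  by case=> y' [n' [Cy' /p_inj[//|//|-> ->]]].
by apply/(sP _ (Cp _ _ Cy)); exists y, n.
Qed.

(** * Coding by elements of the continuum *)

Definition continuum_image (T : Type) : Prop :=
  exists c : continuum -> T, forall t, exists s, c s = t.

Lemma continuum_image_continuum : continuum_image continuum.
Proof. by exists id => t; exists t. Qed.

Lemma continuum_image_bool : continuum_image bool.
Proof. by exists (@^~ 0) => b; exists (fun=> b). Qed.

Lemma continuum_image_seq T : continuum_image T -> continuum_image (nat -> T).
Proof.
move=> [c c_surj]; exists (fun s n => c (fun k => s (pickle (n, k)))) => t.
have [u uP] := choice (fun n => c_surj (t n)).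
exists (fun j => if unpickle j is Some (n, k) then u n k else false).
by apply/funext => n; rewrite -uP; congr c; apply/funext => k; rewrite pickleK.
Qed.

Lemma continuum_image_pair T U :
  continuum_image T -> continuum_image U -> continuum_image (T * U).
Proof.
move=> [c c_surj] [d d_surj].
exists (fun s => (c (fun k => s k.*2), d (fun k => s k.*2.+1))) => -[t u].
have [a <-] := c_surj t; have [b <-] := d_surj u.
exists (fun j => if odd j then b j./2 else a j./2); congr (_, _).
  by congr c; apply/funext => k; rewrite odd_double doubleK.
by congr d; apply/funext => k /=; rewrite odd_double /= uphalf_double.
Qed.

Lemma continuum_image_option T : continuum_image T -> continuum_image (option T).
Proof.
move=> /(continuum_image_pair _ _ continuum_image_bool)[c c_surj].
exists (fun s => if (c s).1 then Some (c s).2 else None) => -[t|].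
  by have [s sP] := c_surj (true, t); exists s; rewrite sP.
have [s sP] := c_surj (false, (c (fun=> false)).2).
by exists s; rewrite sP.
Qed.

(** The values are optional because [D] may be finite or empty, and then some
    numbers have no point of [D] to name. *)
Lemma countable_enum_image {T U : Type} (f : T -> U) (E : set T) (D : set U) :
  countable D -> D `<=` f @` E ->
  exists s : nat -> option T, D = [set x | exists n y, s n = Some y /\ f y = x].
Proof.
move=> /countable_injP[i i_inj] DE.
have /choice[s sP] : forall n, exists o : option T,
    if o is Some y then D (f y) /\ i (f y) = n
    else forall y, ~ (E y /\ D (f y) /\ i (f y) = n).
  move=> n; have [[y [Ey [Dy yn]]]|ny] :=
    pselect (exists y, E y /\ D (f y) /\ i (f y) = n).
  - by exists (Some y).
  - by exists None => y Hy; apply: ny; exists y.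
exists s; apply/seteqP; split=> [x Dx|x [n [y [sn <-]]]] /=; last first.
  by have := sP n; rewrite sn => -[].
have [z Ez zx] := DE _ Dx; exists (i x).
have := sP (i x); case: (s (i x)) => [y [Dy yi]|/(_ z) []].
  by exists y; split=> //; apply: i_inj => //; rewrite inE.
by rewrite zx.
Qed.

(** The form in which the cardinality hypothesis is used: [f @` C] plays the role
    of a subspace of cardinality cf(c).  The map [f] is chosen before the
    decoding function because the codes below are built from the points [f y]. *)
Lemma cofinality_continuum_no_code (X : Type) (C : set continuum) :
  is_cofinality C -> C #<= [set: X] ->
  exists f : continuum -> X, forall (T : Type) (dec : T -> set X),
    continuum_image T -> ~ forall A, A `<=` f @` C -> exists s, A = dec s.
Proof.
move=> cofC /pcard_surjP[g gC].
have [x0 _] : exists x0 : X, True.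
  have [R _ [/(_ point)[y Cy _] _]] := cofC.
  by have [x] := gC _ Cy; exists x.
have /choice[f fP] : forall y, exists x, C y -> g x = y.
  move=> y; have [Cy|nCy] := pselect (C y); last by exists x0.
  by have [x _ xy] := gC _ Cy; exists x.
exists f => T dec [c c_surj] decP.
apply: (continuum_not_onto_powerset_cofinality _ cofC).
exists (fun s => f @^-1` dec (c s)) => B.
have [|t tP] := decP (f @` (C `&` B)).
  by move=> _ [y [Cy _] <-]; exists y.
have [s st] := c_surj t; exists s => y Cy; rewrite st -tP; split.
  by move=> [z [Cz Bz] zy]; rewrite -(fP y Cy) -zy fP.
by move=> By; exists y.
Qed.

(** * Lindelof spaces all of whose subsets are G_delta *)

Section Topology.
Variable X : topologicalType.
Implicit Types (A D K : set X) (x : X).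

Definition all_Gdelta : Prop := forall A, Gdelta A.

Lemma all_Fsigma A : all_Gdelta ->
  exists2 F : nat -> set X, (forall n, closed (F n)) & A = \bigcup_n F n.
Proof.
move=> /(_ (~` A))[U Uo AU]; exists (fun n => ~` U n).
  by move=> n; exact: open_closedC.
by rewrite -setC_bigcap -AU setCK.
Qed.

(** [A] is a countable union of closed sets [~` O n]; each of them is covered by
    countably many members of [U], because [U] together with [O n] is an open
    cover of the whole space. *)
Lemma hereditarily_lindelof : lindelof X -> all_Gdelta ->
  forall A (U : set (set X)), U `<=` open -> A `<=` \bigcup_(W in U) W ->
  exists V, [/\ V `<=` U, countable V & A `<=` \bigcup_(W in V) W].
Proof.
move=> lX GX A U Uo AU; have [O Oo AO] := GX (~` A).
have /choice[V VP] : forall n, exists V : set (set X),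
    [/\ V `<=` U `|` [set O n], countable V & \bigcup_(W in V) W = setT].
  move=> n; apply: lX; split=> [W [/Uo//|->]//|].
  apply/seteqP; split=> // x _.
  have [/AU[W UW Wx]|nAx] := pselect (A x); first by exists W => //; left.
  by exists (O n); [right|have : (~` A) x by []; rewrite AO; apply].
exists (\bigcup_n (V n `&` U)); split.
- by move=> W [n _ []].
- apply: bigcup_countable => // n _; have [_ Vc _] := VP n.
  by apply: sub_countable Vc; apply: subset_card_le; exact: subIsetl.
- move=> x Ax; have [n Onx] : exists n, ~ O n x.
    apply: contrapT => nO; suff : (~` A) x by [].
    by rewrite AO => n _; apply: contrapT => nOx; apply: nO; exists n.
  have [VU _ Vcov] := VP n.
  have [W VW Wx] : (\bigcup_(W in V n) W) x by rewrite Vcov.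
  exists W => //; exists n => //; split=> //.
  by have [//|WO] := VU _ VW; case: Onx; rewrite -WO.
Qed.

(** A subset [A] of [f @` C] is coded by countably many sequences of basic sets
    [e (f y) r], the [n]-th sequence covering [A] inside the [n]-th open set of a
    G_delta presentation of [A]. *)
Lemma lindelof_not_all_Gdelta (C : set continuum) :
  is_cofinality C -> C #<= [set: X] -> lindelof X ->
  (forall x, exists2 B, local_base x B & B #<= [set: continuum]) ->
  ~ all_Gdelta.
Proof.
move=> cofC CX lX chX GX.
have /choice[e eP] : forall x, exists e : continuum -> set X,
    forall W, nbhs x W -> exists2 r, open_nbhs x (e r) & e r `<=` W.
  move=> x; have [B [Bx xB] /pcard_surjP[e eB]] := chX x.
  exists e => W /xB[U BU UW]; have [r _ rU] := eB _ BU.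
  by exists r; rewrite rU //; exact: Bx.
have [f no_code] := cofinality_continuum_no_code _ _ cofC CX.
pose E (yr : continuum * continuum) := e (f yr.1) yr.2.
apply: (no_code (nat -> nat -> option (continuum * continuum)) (fun s =>
    \bigcap_n [set x | exists m yr, s n m = Some yr /\ E yr x])).
  do 2 apply: continuum_image_seq; apply: continuum_image_option.
  by apply: continuum_image_pair; exact: continuum_image_continuum.
move=> A AfC; have [O Oo AO] := GX A.
have /choice[s sP] : forall n, exists t : nat -> option (continuum * continuum),
    (forall m yr, t m = Some yr -> E yr `<=` O n) /\
    A `<=` [set x | exists m yr, t m = Some yr /\ E yr x].
  move=> n.
  have [||V [VE Vc AV]] := hereditarily_lindelof lX GX A
      [set W | [/\ open W, W `<=` O n & exists yr, E yr = W]].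
  - by move=> W [].
  - move=> x Ax; have [y Cy yx] := AfC _ Ax.
    have [|r [ro rx] rO] := eP x (O n).
      by apply: open_nbhs_nbhs; split=> //; move: Ax; rewrite AO; apply.
    exists (e x r) => //; split=> //.
    by exists (y, r); rewrite /E /= yx.
  - have [|t Vt] := countable_enum_image E setT V Vc.
      by move=> W /VE[_ _ [yr <-]]; exists yr.
    exists t; split=> [m yr tm|x /AV[W + Wx]].
      have /VE[] // : V (E yr) by rewrite Vt; exists m, yr.
    by rewrite Vt => -[m [yr [tm EW]]]; exists m, yr; rewrite EW.
exists s; apply/seteqP; split=> [x Ax n _|x xs].
  by have [_] := sP n; apply.
rewrite AO => n _; have [m [yr [sm Ex]]] := xs n I.
by have [+ _] := sP n => /(_ _ _ sm); apply.
Qed.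

(** * Nested sequences of closed sets *)

(** Cantor's intersection property for closed sets inside [K]: the common
    consequence of compactness of [K] and of countable compactness that the
    arguments below rely on. *)
Definition nested_compact K : Prop :=
  forall F : nat -> set X, (forall n, closed (F n)) -> (forall n, F n !=set0) ->
    (forall n, F n.+1 `<=` F n) -> F 0 `<=` K -> \bigcap_n F n !=set0.

Lemma nested_le (F : nat -> set X) : (forall n, F n.+1 `<=` F n) ->
  forall m n, m <= n -> F n `<=` F m.
Proof.
move=> Fd m; elim=> [|n ih]; first by rewrite leqn0 => /eqP ->.
by rewrite leq_eqVlt => /orP[/eqP->//|]; rewrite ltnS => /ih H x /Fd /H.
Qed.

Lemma compact_nested_compact K : compact K -> nested_compact K.
Proof.
move=> Kc F Fc F0 Fd FK; have Fle := nested_le _ Fd.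
have FF : ProperFilter (filter_from setT F).
  apply: filter_from_proper => [|n _]; last exact: F0.
  apply: filter_from_filter; first by exists 0.
  move=> m n _ _; exists (maxn m n) => // x Fx; split.
    by apply: Fle Fx; exact: leq_maxl.
  by apply: Fle Fx; exact: leq_maxr.
have [|x [_ xF]] := Kc (filter_from setT F) FF; first by exists 0.
exists x => n _; apply: Fc => W xW.
by apply: xF => //; exists n.
Qed.

Lemma countably_compact_nested_compact :
  countably_compact X -> nested_compact setT.
Proof.
move=> cX F Fc F0 Fd _; have Fle := nested_le _ Fd; apply: contrapT => nF.
have [|| V [VU /finite_seqP[s Vs] Vcov]] := cX (range (fun n => ~` F n)).
- exact: card_image_le.
- split=> [_ [n _ <-]|]; first exact: closed_openC.
  apply/seteqP; split=> // x _; apply: contrapT => nx; apply: nF.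
  exists x => n _; apply: contrapT => nFx; apply: nx.
  by exists (~` F n) => //; exists n.
have {}VU W : W \in s -> exists n, ~` F n = W.
  by move=> Ws; have [|n _ <-] := VU W; [rewrite Vs|exists n].
have [N NP] : exists N, forall W, W \in s -> F N `<=` ~` W.
  elim: s {Vs} VU => [_|W s ih VU]; first by exists 0.
  have [|N NP] := ih; first by move=> W' W's; apply: VU; rewrite inE W's orbT.
  have [|n nW] := VU W; first by rewrite inE eqxx.
  exists (maxn N n) => W'; rewrite inE => /orP[/eqP->|/NP H].
    by rewrite -nW setCK; apply: Fle; exact: leq_maxr.
  by move=> x /(Fle N _ (leq_maxl _ _)) /H.
have [x FNx] := F0 N; have : (\bigcup_(W in V) W) x by rewrite Vcov.
by move=> [W]; rewrite Vs => /NP/(_ x FNx).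
Qed.

(** * First countability *)

Hypothesis X_T3 : T3_space X.

Lemma regular_shrink x A : nbhs x A ->
  exists2 V, open_nbhs x V & closure V `<=` A.
Proof.
have [regX _] := X_T3 => /(regX x)[B + BA].
rewrite nbhsE => -[V xV VB]; exists V => //.
by apply: subset_trans BA; exact: closureS.
Qed.

(** Shrink [K] by regularity to neighbourhoods [V n] of [x] whose closures
    decrease to [x].  If no [V n] fitted inside an open neighbourhood [W'] of
    [x], the closed sets [closure (V n) `\` W'] would be a nested sequence of
    nonempty sets with empty intersection. *)
Lemma countable_local_base x K : nbhs x K -> nested_compact K -> all_Gdelta ->
  exists2 V : nat -> set X, (forall n, open_nbhs x (V n)) &
    forall W, nbhs x W -> exists n, V n `<=` W.
Proof.
move=> xK Kc GX; have [O Oo xO] := GX [set x].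
have /choice[r rP] : forall A, exists V, nbhs x A ->
    open_nbhs x V /\ closure V `<=` A.
  move=> A; have [/regular_shrink[V xV VA]|nA] := pselect (nbhs x A).
    by exists V.
  by exists A.
pose V := fix V n := if n is n'.+1 then r (V n' `&` O n') else r K.
have xV n : open_nbhs x (V n).
  elim: n => [|n ih] /=; first by have [] := rP _ xK.
  have [] // := rP (V n `&` O n); apply: filterI; apply: open_nbhs_nbhs => //.
  by split=> //; have : [set x] x by []; rewrite xO; apply.
have VS n : closure (V n.+1) `<=` V n `&` O n.
  have [] // := rP (V n `&` O n); apply: filterI; apply: open_nbhs_nbhs => //.
  by split=> //; have : [set x] x by []; rewrite xO; apply.
exists V => // W; rewrite nbhsE => -[W' [W'o W'x] W'W]; apply: contrapT => nV.
have [|n|n|y Hy|y yP] := Kc (fun n => closure (V n) `&` ~` W').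
- by move=> n; apply: closedI; [exact: closed_closure|exact: open_closedC].
- apply: contrapT => nVW; apply: nV; exists n => y Vy; apply: W'W.
  apply: contrapT => nW'y; apply: nVW; exists y; split=> //.
  exact: subset_closure.
- by apply: setSI => y /VS[Vy _]; exact: subset_closure.
- by have [_ H] := rP _ xK; apply: H; have [] := Hy.
have yx : y = x.
  suff : [set x] y by [].
  by rewrite xO => n _; have [/VS[_]] := yP n.+1 I.
by have [_] := yP 0 I; rewrite yx; apply.
Qed.

(** * Countably compact spaces all of whose subsets are G_delta *)

(** All subsets of a closed discrete set are closed, so the tails of an infinite
    sequence in it would be nested closed sets with empty intersection. *)
Lemma nested_compact_discrete_finite D : nested_compact setT -> closed D ->
  discrete_subspace D -> finite_set D.
Proof.
move=> Xc Dc Dd; apply: contrapT => /infiniteP /pcard_surjP[g gD].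
have /choice[i iP] : forall n, exists x, D x /\ g x = n.
  by move=> n; have [//|x Dx xn] := gD n; exists x.
have i_inj : injective i.
  by move=> m n mn; have [_ <-] := iP m; rewrite mn; have [_ ->] := iP n.
have Di n : D (i n) by have [] := iP n.
have [n|n|n|//|x xP] := Xc (fun n => i @` [set k | n <= k]).
- move=> x xi; have Dx : D x.
    by apply: Dc; apply: closureS xi => _ [k _ <-].
  have [_ [V xV VD]] := Dd _ Dx.
  have [y [[k nk ky] Vy]] := xi _ xV.
  have : (V `&` D) y by split=> //; rewrite -ky.
  by rewrite VD => <-; exists k.
- by exists (i n); exists n => /=.
- by move=> _ [k nk <-]; exists k => //; exact: ltnW.
have [k _ kx] := xP 0 I; have [l kl] := xP k.+1 I.
by rewrite -kx => /i_inj lk; move: kl; rewrite /= lk ltnn.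
Qed.

(** The closed pieces of an F_sigma presentation of [D] are again discrete,
    hence finite. *)
Lemma nested_compact_discrete_countable D : nested_compact setT -> all_Gdelta ->
  discrete_subspace D -> countable D.
Proof.
move=> Xc GX Dd; have [F Fc DF] := all_Fsigma D GX.
rewrite DF; apply: bigcup_countable => // n _; apply: finite_set_countable.
apply: nested_compact_discrete_finite => // x Fx.
have FD : F n `<=` D by rewrite DF => y Fy; exists n.
have [_ [V xV VD]] := Dd _ (FD _ Fx).
split; first by rewrite inE.
exists V => //; apply/seteqP; split=> [y [Vy Fy]|_ ->].
  by rewrite -VD; split=> //; exact: FD.
by split=> //; exact: nbhs_singleton.
Qed.

Definition crowded A : Prop :=
  forall x, A x -> forall W, nbhs x W -> exists y, [/\ A y, W y & y <> x].

Lemma not_crowded_isolated A : ~ crowded A -> isolated A !=set0.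
Proof.
move=> nA; apply: contrapT => nI; apply: nA => x Ax W xW; apply: contrapT => ny.
apply: nI; exists x; split; first by rewrite inE.
exists W => //; apply/seteqP; split=> [y [Wy Ay]|_ ->].
  by apply: contrapT => yx; apply: ny; exists y.
by split=> //; exact: nbhs_singleton.
Qed.

(** A Baire category argument.  If the range of [q] is the intersection of the
    open sets [O n], build open sets [W n] meeting the range such that the
    closure of [W n.+1] lies in [W n], in [O n], and misses [q n]; crowdedness
    makes it possible to avoid [q n].  A point common to all the closures lies in
    every [O n], hence is some [q n], which is excluded. *)
Lemma countable_not_crowded (q : nat -> X) :
  nested_compact setT -> all_Gdelta -> ~ crowded (range q).
Proof.
move=> Xc GX Qc; have [O Oo QO] := GX (range q).
have qO k n : O n (q k) by have : range q (q k) by []; rewrite QO; apply.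
have /choice[r rP] : forall nW : nat * set X, exists W', open nW.2 ->
    (exists k, nW.2 (q k)) ->
    [/\ open W', exists k, W' (q k) &
        closure W' `<=` nW.2 `&` O nW.1 `&` ~` [set q nW.1]].
  move=> [n W] /=; have [[Wo [k Wk]]|nW] :=
    pselect (open W /\ exists k, W (q k)); last first.
    by exists W => Wo Wk; case: nW.
  have [l [Wl lk]] : exists l, W (q l) /\ q l <> q n.
    have [kn|kn] := pselect (q k = q n); last by exists k.
    have [|y [[l _ <-] Wl lk]] := Qc _ (imageT q k) W.
      exact: open_nbhs_nbhs.
    by exists l; split=> //; rewrite -kn.
  have [|W' [W'o W'l] W'W] :=
      regular_shrink (q l) (W `&` O n `&` ~` [set q n]).
    apply: open_nbhs_nbhs; split=> //; apply: openI; first exact: openI.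
    apply: closed_openC; apply: accessible_closed_set1.
    by have [] := X_T3.
  by exists W' => _ _; split=> //; exists l.
pose W := fix W n := if n is n'.+1 then r (n', W n') else setT.
have WP n : open (W n) /\ exists k, W n (q k).
  elim: n => [|n [Wo Wk]] /=; last by have [] := rP (n, W n) Wo Wk.
  by split; [exact: openT | exists 0].
have WS n : closure (W n.+1) `<=` W n `&` O n `&` ~` [set q n].
  by have [Wo Wk] := WP n; have [] := rP (n, W n) Wo Wk.
have [n|n|n|//|x xP] := Xc (fun n => closure (W n)).
- exact: closed_closure.
- by have [_ [k Wk]] := WP n; exists (q k); exact: subset_closure.
- by move=> x /WS[[Wx _] _]; exact: subset_closure.
have [n _ nx] : range q x by rewrite QO => n _; have /WS[[]] := xP n.+1 I.
by have /WS[_] := xP n.+1 I; apply; rewrite nx.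
Qed.

(** By first countability a point [x] of [A] has points [p (x, k)] of [A], other
    than [x], in each of its basic neighbourhoods; the points reached from one
    point of [A] by iterating [p] along finite sequences of indices form a
    countable crowded set. *)
Lemma crowded_empty A : nested_compact setT -> all_Gdelta -> crowded A ->
  A = set0.
Proof.
move=> Xc GX Ac; apply: contrapT => /eqP/set0P[a Aa].
have /choice[V VP] : forall x, exists V : nat -> set X,
    (forall n, open_nbhs x (V n)) /\ forall W, nbhs x W -> exists n, V n `<=` W.
  move=> x; have [V] := countable_local_base x setT filterT Xc GX.
  by exists V.
have /choice[p pP] : forall xn : X * nat, exists y, A xn.1 ->
    [/\ A y, V xn.1 xn.2 y & y <> xn.1].
  move=> [x n] /=; have [Ax|nAx] := pselect (A x); last by exists x.
  have [Vx _] := VP x; have [y yP] := Ac _ Ax _ (open_nbhs_nbhs (Vx n)).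
  by exists y.
pose q n := foldl (fun x k => p (x, k)) a (odflt [::] (unpickle n)).
have qA n : A (q n).
  rewrite /q; elim/last_ind: (odflt _ _) => [//|s k ih].
  by rewrite -cats1 foldl_cat /=; have [] := pP (_, k) ih.
apply: (countable_not_crowded q Xc GX) => _ [n _ <-] W qW.
have [_ /(_ _ qW)[k kW]] := VP (q n).
have [_ Vp pN] := pP (q n, k) (qA n).
exists (p (q n, k)); split=> //; last exact: kW.
exists (pickle (rcons (odflt [::] (unpickle n)) k)) => //.
by rewrite /q pickleK /= -cats1 foldl_cat.
Qed.

(** The space being scattered, the part of [A] in an open neighbourhood of one of
    its points has an isolated point, which is isolated in [A] as well. *)
Lemma isolated_dense A : nested_compact setT -> all_Gdelta ->
  A `<=` closure (isolated A).
Proof.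
move=> Xc GX x Ax W; rewrite nbhsE => -[W' [W'o W'x] W'W].
have [|y [+ [V yV VA]]] := not_crowded_isolated (A `&` W').
  by move=> /(crowded_empty _ Xc GX) E; have : (A `&` W') x by []; rewrite E.
rewrite inE => -[Ay W'y]; exists y; split; last exact: W'W.
split; first by rewrite inE.
exists (V `&` W'); last by rewrite -VA -setIA (setIC W').
by apply: filterI => //; exact: open_nbhs_nbhs.
Qed.

Lemma countable_dense_subset A : nested_compact setT -> all_Gdelta ->
  exists D, [/\ D `<=` A, countable D & A `<=` closure D].
Proof.
move=> Xc GX; exists (isolated A); split; first exact: isolatedS.
  apply: nested_compact_discrete_countable => // x Ix.
  have [Ax [V xV VA]] := Ix; split; first by rewrite inE.
  exists V => //; apply/seteqP; split=> [y [Vy /isolatedS Ay]|_ ->].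
    by rewrite -VA.
  by split=> //; exact: nbhs_singleton.
exact: isolated_dense.
Qed.

(** A subset [A] of [f @` C] is an F_sigma; it is coded by countably many
    sequences of indices, the [n]-th one enumerating a countable dense subset of
    the [n]-th closed piece of [A]. *)
Lemma nested_compact_not_all_Gdelta (C : set continuum) :
  is_cofinality C -> C #<= [set: X] -> nested_compact setT -> ~ all_Gdelta.
Proof.
move=> cofC CX Xc GX.
have [f no_code] := cofinality_continuum_no_code _ _ cofC CX.
apply: (no_code (nat -> nat -> option continuum) (fun s =>
    \bigcup_n closure [set x | exists m y, s n m = Some y /\ f y = x])).
  do 2 apply: continuum_image_seq; apply: continuum_image_option.
  exact: continuum_image_continuum.
move=> A AfC; have [F Fc AF] := all_Fsigma A GX.
have /choice[s sP] : forall n, exists t : nat -> option continuum,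
    F n = closure [set x | exists m y, t m = Some y /\ f y = x].
  move=> n; have [D [DF Dc FD]] := countable_dense_subset (F n) Xc GX.
  have [|t Dt] := countable_enum_image f C D Dc.
    by move=> x /DF Fx; apply: AfC; rewrite AF; exists n.
  exists t; rewrite -Dt; apply/seteqP; split=> //.
  by apply: subset_trans (Fc n); exact: closureS.
by exists s; rewrite AF; apply: eq_bigcupr => n _.
Qed.

End Topology.

Theorem corollary4p3 (X : topologicalType) (X_T3 : T3_space X)
    (cf_le_X : exists2 C : set continuum, is_cofinality C & C #<= [set: X]) :
  [/\ (lindelof X -> character_le X continuum -> ~ Q_space X),
      (lindelof X -> locally_compact [set: X] -> ~ Q_space X),
      (compact [set: X] -> ~ Q_space X) &
      (countably_compact X -> ~ Q_space X)].
Proof.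
have [C cofC CX] := cf_le_X; split.
- move=> lX chX [_]; apply: (lindelof_not_all_Gdelta _ C) => // x.
  by have [B [Bx _] Bc] := chX x; exists B.
- move=> lX lcX [_ GX]; apply: (lindelof_not_all_Gdelta _ C cofC CX lX _ GX) => x.
  have [U xU [Uc _]] := lcX x I.
  have [||V xV Vx] := countable_local_base _ X_T3 x U _ _ GX.
  + by move: xU; rewrite /within /= => xU; apply: filterS xU => y /=; apply.
  + exact: compact_nested_compact.
  exists (range V).
    split=> [_ [n _ <-]|W /Vx[n nW]]; first exact: xV.
    by exists (V n).
  apply: (@card_le_trans _ _ _ [set: nat]); first exact: card_image_le.
  apply/pcard_injP; exists (fun n k => k == n) => m n _ _.
  by move=> /(congr1 (@^~ m)); rewrite eqxx => /esym/eqP.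
- move=> /compact_nested_compact Xc [_].
  exact: (nested_compact_not_all_Gdelta _ X_T3 C).
- move=> /countably_compact_nested_compact Xc [_].
  exact: (nested_compact_not_all_Gdelta _ X_T3 C).
Qed.
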